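(* Let $f(t)\in\mathbb{R}[t]$ be any monic polynomial of degree $n$ with coefficients in $\mathbb{R}$, where $n\ge 1$. Then there exists an $n\times n$ X-matrix $A\in\mathrm{Mat}(n,\mathbb{R})$ such that $\chi_A(t)=f(t)$.
   Context: $\mathrm{Mat}(n,\mathbb{R})$ is the ring of $n\times n$ real matrices. A matrix $A=(a_{i,j})\in\mathrm{Mat}(n,\mathbb{R})$ is an X-matrix if $a_{i,j}=0$ whenever $i\neq j$ and $i+j\neq n+1$. The characteristic polynomial of $A$ is $\chi_A(t)=\det(tI-A)$. *)

(* Defs.v *)
From HB Require Import structures.
From mathcomp Require Import all_boot all_order all_algebra.
Set Implicit Arguments.
Unset Strict Implicit.
Unset Printing Implicit Defensive.
Import GRing.Theory.
Local Open Scope ring_scope.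

(* Ordinals i, j : 'I_n are 0-based; the 1-based row and column numbers are
   i.+1 and j.+1. *)
Definition X_matrix (R : nzRingType) (n : nat) (A : 'M[R]_n) : Prop :=
  forall i j : 'I_n, i != j -> (i.+1 + j.+1)%N != n.+1 -> A i j = 0.

(* Main.v *)
Require Import Defs.
From HB Require Import structures.
From mathcomp Require Import all_boot all_order all_algebra.
From mathcomp Require Import reals.
From mathcomp Require Import fingroup perm complex.
Set Implicit Arguments.
Unset Strict Implicit.
Unset Printing Implicit Defensive.
Import GRing.Theory.
Local Open Scope ring_scope.

(** An X-matrix of size [n + 2] is an X-matrix of size [n] surrounded by a frame
    whose only nonzero entries are its four corners.  The corners form a
    two-by-two matrix [Q] that does not interact with the inner matrix [A]:
    listing the first and last indices before the others turns the whole
    matrix into the block diagonal matrix with blocks [Q] and [A], so its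
    characteristic polynomial is [char_poly Q * char_poly A]
    ([X_matrix_border]).

    There is no constraint on [Q], so any monic quadratic polynomial can be
    split off in this way, with its companion matrix as [Q].  A real polynomial
    of degree at least two does have a monic quadratic divisor
    ([quadratic_factor]), and induction on the degree in steps of two reduces
    everything to degrees zero and one, where every matrix is an X-matrix. *)

(** Take a complex root [a + ib].  Either it is real, or
    [q = (X - a)^2 + b^2] vanishes at it and so does the remainder of [p]
    modulo [q]; a real polynomial of degree at most one with a nonreal root is
    zero. *)
Lemma real_root_or_quadratic_factor (R : rcfType) (p : {poly R}) :
    (1 < size p)%N ->
  (exists x, root p x) \/
  (exists q : {poly R}, [/\ q \is monic, size q = 3 & q %| p]).
Proof.
move=> p_gt1; pose toC := real_complex R.
have /closed_rootP[[a b] pz0]: size (map_poly toC p) != 1%N.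
  by rewrite size_map_poly gtn_eqF.
have [b0|b_neq0] := eqVneq b 0.
  by left; exists a; rewrite b0 (fmorph_root toC) in pz0.
right; pose q : {poly R} := ('X - a%:P) ^+ 2 + (b ^+ 2)%:P.
have sz_sq : size (('X - a%:P) ^+ 2 : {poly R}) = 3 by rewrite size_exp_XsubC.
have lt_sz : (size (b ^+ 2)%:P < size (('X - a%:P) ^+ 2 : {poly R}))%N.
  by rewrite sz_sq; apply: leq_ltn_trans (size_polyC_leq1 _) _.
have sz_q : size q = 3 by rewrite size_polyDl.
exists q; split=> //.
  by rewrite monicE lead_coefDl // -monicE monic_exp // monicXsubC.
have qz0 : (map_poly toC q).[(a +i* b)%C] = 0.
  rewrite rmorphD rmorphXn rmorphB /= map_polyX !map_polyC /= !hornerE.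
  by apply/eqP; rewrite eq_complex /=; simpc; rewrite -expr2 addNr eqxx.
have r_le2 : (size (p %% q)%R <= 2)%N.
  by have := ltn_modp p q; rewrite -size_poly_eq0 sz_q.
have : (map_poly toC (p %% q)).[(a +i* b)%C] = 0.
  move: pz0; rewrite rootE {1}(divp_eq p q) rmorphD rmorphM /=.
  by rewrite hornerD hornerM qz0 mulr0 add0r => /eqP.
rewrite (@horner_coef_wide _ 2) ?size_map_poly // big_ord_recl big_ord1.
rewrite !coef_map expr0 expr1 mulr1 /=; simpc.
case=> re0 im0; move: re0 im0.
(* The two equations are the real and imaginary parts of the value of the
   remainder; as [b] is nonzero, the latter kills its leading coefficient. *)
move=> re0 /eqP; rewrite mulf_eq0 (negPf b_neq0) orbF => /eqP r1.
move: re0; rewrite r1 mul0r addr0 => r0.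
apply/eqP/polyP=> -[|[|i]]; rewrite coef0 //.
by rewrite nth_default // (leq_trans r_le2).
Qed.

(** If the first root found is real, the cofactor is still nonconstant: it
    either has a quadratic factor or a second real root, and two real roots
    make a quadratic factor. *)
Lemma quadratic_factor (R : rcfType) (p : {poly R}) : (2 < size p)%N ->
  exists q : {poly R}, [/\ q \is monic, size q = 3 & q %| p].
Proof.
move=> p_gt2.
have [[x /factor_theorem[g p_g]]|//] :=
  real_root_or_quadratic_factor (ltnW p_gt2).
have g_gt1 : (1 < size g)%N.
  move: p_gt2; rewrite p_g; have [->|g_neq0] := eqVneq g 0.
    by rewrite mul0r size_poly0.
  by rewrite size_Mmonic ?monicXsubC // size_XsubC addn2.
have [[y /factor_theorem[h g_h]]|[q [q_monic sz_q q_g]]] :=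
  real_root_or_quadratic_factor g_gt1.
- exists (('X - y%:P) * ('X - x%:P)); split.
  + by rewrite monicMl monicXsubC.
  + by rewrite size_Mmonic ?monicXsubC ?polyXsubC_eq0 // !size_XsubC.
  + by rewrite p_g g_h -mulrA dvdp_mull.
- by exists q; split=> //; rewrite p_g dvdp_mulr.
Qed.

(** Sends the first two indices to the two ends and shifts the others down by
    one, so that a two-by-two block followed by an [n]-by-[n] block becomes the
    corners and the interior of a matrix of size [n + 2]. *)
Definition border_perm (n : nat) : 'S_n.+2 :=
  lift_perm ord0 ord0 (lift_perm ord0 ord_max 1%g).

Lemma border_perm_inner n (k : 'I_n) :
  border_perm n (rshift 2 k) = k.+1 :> nat.
Proof.
have -> : rshift 2 k = lift ord0 (lift ord0 k) by apply: ord_inj.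
rewrite !lift_perm_lift perm1 lift0.
by rewrite lift_max.
Qed.

Lemma border_perm_outer n (k : 'I_2) :
  border_perm n (lshift n k) = (if k == ord0 then 0%N else n.+1) :> nat.
Proof.
case: (unliftP ord0 k) => [l|] ->.
  have -> : lshift n (lift ord0 l) = lift ord0 ord0.
    by apply: ord_inj; rewrite /= ord1.
  by rewrite lift_perm_lift lift_perm_id.
have -> : lshift n (ord0 : 'I_2) = (ord0 : 'I_n.+2) by apply: ord_inj.
by rewrite lift_perm_id.
Qed.

(** Applying [s] to rows and columns alike commutes with subtracting from a
    scalar matrix, and the two signs of [s] cancel in the determinant. *)
Lemma char_poly_perm (R : comNzRingType) n (s : 'S_n) (A : 'M[R]_n) :
  char_poly (row_perm s (col_perm s A)) = char_poly A.
Proof.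
have E : char_poly_mx (row_perm s (col_perm s A)) =
    row_perm s (col_perm s (char_poly_mx A)).
  by apply/matrixP=> i j; rewrite !mxE (inj_eq perm_inj).
rewrite /char_poly E row_permE col_permE !det_mulmx !det_perm odd_permV.
by rewrite mulrCA -expr2 sqrr_sign mulr1.
Qed.

(** The permuted block diagonal matrix is an X-matrix because the two ends are
    exchanged by the reversal of indices, so that the corners lie on the two
    diagonals, and because the interior indices of the large matrix are those
    of [A] plus one, so that its diagonals extend those of [A]. *)
Lemma X_matrix_border (R : comNzRingType) n (Q : 'M[R]_2) (A : 'M[R]_n) :
    X_matrix A ->
  exists B : 'M[R]_n.+2, X_matrix B /\ char_poly B = char_poly Q * char_poly A.
Proof.
move=> XA; set s := border_perm n.
pose B : 'M[R]_n.+2 := block_mx Q 0 0 A.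
exists (row_perm s^-1%g (col_perm s^-1%g B)); split; last first.
  by rewrite char_poly_perm /char_poly (char_block_diag_mx Q A)
     (@det_ublock _ 2 n).
(* Reindex by block positions, so that [i] and [j] now range over rows of [B]. *)
move=> i j; rewrite -(permKV s i) -(permKV s j).
move: (s^-1%g i) (s^-1%g j) => {}i {}j.
rewrite (inj_eq perm_inj) !mxE !permK.
case: (@splitP 2 n i) => i' Ei; rewrite mxE;
  case: (@splitP 2 n j) => j' Ej; rewrite ?mxE //.
- have -> : i = lshift n i' by apply: ord_inj.
  have -> : j = lshift n j' by apply: ord_inj.
  move=> ij; have {ij}: i' != j' by apply: contraNneq ij => ->.
  rewrite !border_perm_outer.
  by case: i' j' {Ei Ej} => [[|[|//]] ?] [[|[|//]] ?] //=;
    rewrite ?addn1 ?add1n eqxx.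
- have -> : i = rshift 2 i' by apply: ord_inj.
  have -> : j = rshift 2 j' by apply: ord_inj.
  move=> ij; have {ij} ij: i' != j' by apply: contraNneq ij => ->.
  rewrite !border_perm_inner => sum.
  apply: XA => //; apply: contraNneq sum => ij_anti.
  by rewrite addSn addnS ij_anti.
Qed.

(** The companion matrix, with its size [(size p).-1] replaced by [n]. *)
Lemma char_poly_surj (R : comNzRingType) n (p : {poly R}) :
  p \is monic -> size p = n.+1 -> exists A : 'M[R]_n, char_poly A = p.
Proof.
move=> p_monic sz_p; have := companionmxK p_monic.
by move: (companionmx p); rewrite sz_p => A; exists A.
Qed.

Lemma X_matrix_realization (R : rcfType) n (f : {poly R}) :
    f \is monic -> size f = n.+1 ->
  exists A : 'M[R]_n, X_matrix A /\ char_poly A = f.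
Proof.
elim/ltn_ind: n f => -[|[|n]] IHn f f_monic sz_f.
- have [A <-] := char_poly_surj f_monic sz_f.
  by exists A; split=> // -[].
- have [A <-] := char_poly_surj f_monic sz_f.
  by exists A; split=> // i j; rewrite !ord1 eqxx.
have [|q [q_monic sz_q /dvdpP[g f_gq]]] := @quadratic_factor _ f.
  by rewrite sz_f.
have g_monic : g \is monic by rewrite -(monicMr g q_monic) -f_gq.
have sz_g : size g = n.+1.
  move: sz_f; rewrite f_gq size_Mmonic ?monic_neq0 // sz_q.
  by rewrite addn3 /= => -[].
rewrite f_gq; have [A [XA <-]] := IHn n (ltnW (leqnn n.+2)) g g_monic sz_g.
have [Q <-] := char_poly_surj q_monic sz_q.
have [B [XB char_B]] := X_matrix_border Q XA.
by exists B; split=> //; rewrite char_B mulrC.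
Qed.

Theorem theorem24 (R : realType) (n : nat) (f : {poly R}) (hn : (1 <= n)%N)
    (fmonic : f \is monic) (fdeg : size f = n.+1) :
  exists A : 'M[R]_n, X_matrix A /\ char_poly A = f.
Proof. exact: X_matrix_realization. Qed.
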